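(* Let $G$ be an abelian group. Then the following conditions are equivalent: (a) $\widetilde{s_0}(G)=0$; (b) $t_p(G)$ is finite for every prime $p$ and $r_0(G)$ is finite; (c) $G$ is hereditarily Hopfian.
   Context: $\mathbb N=\{0,1,2,\dots\}$ and $\mathbb N_+=\mathbb N\setminus\{0\}$. Let $\phi$ be an endomorphism of an abelian group $G$. A null string of $\phi$ is a sequence $S=\{x_n\}_{n\in\mathbb N}$ of pairwise distinct elements of $G$ such that $\phi(x_n)=x_{n-1}$ for every $n\in\mathbb N_+$, $x_0\neq 0$, and $\phi^k(x_0)=0$ for some $k\in\mathbb N_+$. Define $s_0(\phi)$ as the supremum of the cardinalities $|\mathcal F|$, where $\mathcal F$ ranges over the families of pairwise disjoint null strings of $\phi$; if this supremum is infinite it is set equal to the symbol $\infty$. For an abelian group $G$, $s_0(G)=\sup\{s_0(\phi):\phi\in\mathrm{End}(G)\}$ and $\widetilde{s_0}(G)=\sup\{s_0(H):H\leq G\}$, where $H$ ranges over all subgroups of $G$. $t_p(G)$ is the $p$-component of $G$ and $r_0(G)$ its torsion-free rank. A group is Hopfian if each of its surjective endomorphisms is an automorphism, and hereditarily Hopfian if each of its subgroups is Hopfian. *)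

(* Defs.v *)
From HB Require Import structures.
From mathcomp Require Import all_boot all_order all_algebra.
From mathcomp Require Import finmap.
From mathcomp Require Import boolp classical_sets functions cardinality.
From mathcomp Require Import reals constructive_ereal ereal.
From mathcomp Require Import measure.

Set Implicit Arguments.
Unset Strict Implicit.
Unset Printing Implicit Defensive.
Import Order.TTheory GRing.Theory Num.Theory.

Local Open Scope classical_set_scope.
Local Open Scope ring_scope.

(* The carrier of a subgroup, as an abelian group in its own right. Subgroups *)
(* are boolean predicates closed under 0 and subtraction; by excluded middle  *)
(* (boolp) these are all the subgroups.                                       *)
Definition subgroup (G : zmodType) (H : zmodClosed G) : Type :=
  {x : G | x \in H}.
HB.instance Definition _ (G : zmodType) (H : zmodClosed G) :=
  SubChoice.on (subgroup H).
HB.instance Definition _ (G : zmodType) (H : zmodClosed G) :=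
  [SubChoice_isSubZmodule of subgroup H by <:].

Definition null_string (G : zmodType) (phi : G -> G) (x : nat -> G) : Prop :=
  [/\ injective x,
      forall n : nat, phi (x n.+1) = x n,
      x 0%N <> 0 &
      exists2 k : nat, (0 < k)%N & iter k phi (x 0%N) = 0].

(* [trivIset F range]: members of F at distinct indices have disjoint ranges. *)
(* Ranges are nonempty, so counting the sequences in F is the same as         *)
(* counting the underlying sets.                                              *)
Definition disjoint_null_strings (G : zmodType) (phi : G -> G)
    (F : set (nat -> G)) : Prop :=
  F `<=` null_string phi /\ trivIset F (fun x : nat -> G => range x).

(* Elements of N, together with the symbol oo, are represented in the extended *)
(* reals \bar R, where R is any model of the real numbers: [counting A] is the *)
(* number of elements of A if A is finite and +oo otherwise, so all infinite   *)
(* cardinalities are identified. Every supremum below is taken over a nonempty *)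
(* set of such values, so it is again in N or +oo.                             *)
Definition string_number_end (R : realType) (G : zmodType)
    (phi : {additive G -> G}) : \bar R :=
  ereal_sup [set counting F | F in disjoint_null_strings phi].

Definition string_number (R : realType) (G : zmodType) : \bar R :=
  ereal_sup (range (@string_number_end R G)).

Definition hereditary_string_number (R : realType) (G : zmodType) : \bar R :=
  ereal_sup (range (fun H : zmodClosed G => string_number R (subgroup H))).

Definition p_component (p : nat) (G : zmodType) : set G :=
  [set x | exists n : nat, x *+ (p ^ n) = 0].
Arguments p_component : clear implicits.

Definition Z_independent (G : zmodType) (A : set G) : Prop :=
  forall (X : {fset G}) (c : G -> int),
    [set` X] `<=` A -> \sum_(x <- X) x *~ c x = 0 ->
    forall x : G, x \in X -> c x = 0.

Definition torsion_free_rank (R : realType) (G : zmodType) : \bar R :=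
  ereal_sup [set counting A | A in @Z_independent G].

Definition hopfian (G : zmodType) : Prop :=
  forall f : {additive G -> G},
    (forall y : G, exists x : G, f x = y) -> bijective f.

Definition hereditarily_hopfian (G : zmodType) : Prop :=
  forall H : zmodClosed G, hopfian (subgroup H).

(* Main.v *)
Require Import Defs.
From mathcomp Require Import all_boot all_order all_algebra.
From mathcomp Require Import classical_sets cardinality.
From mathcomp Require Import reals constructive_ereal.
From HB Require Import structures.
From mathcomp Require Import finmap boolp ereal measure.

(** A null string lives on the part of a group where an endomorphism is both
    surjective and far from injective, and this is what links the conditions.

    Hopfian subgroups exclude null strings
    ([hereditarily_hopfian_string_free]).  If [phi] acts on a subgroup [H],
    the elements of [H] that start an infinite backward [phi]-orbit form a
    subgroup [V] which [phi] maps onto itself.  A null string of [phi] lies in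
    [V] and is killed by a power of [phi], so [V] is not Hopfian.

    The finiteness conditions imply that every subgroup is Hopfian
    ([finite_components_rank_hopfian]).  Let [f] be a surjective endomorphism
    of a subgroup and follow a backward orbit [y] of a nonzero [x] in the
    kernel.  Since [f ^ n] kills the terms of index below [n] and sends [y n]
    to [x], the terms are distinct, and they are independent if [x] has
    infinite order; finite rank therefore makes the kernel torsion.  Then [x]
    may be chosen of prime order [p] and its backward orbit inside the
    [p]-component, which would make that component infinite.

    Without the finiteness conditions a null string exists
    ([string_free_finite_components_rank]).  If the rank is infinite, there is
    an infinite independent sequence; if the [p]-socle is infinite, there is
    an infinite sequence independent over [Z/p].  In both cases the shift of
    the sequence extends to the subgroup that it generates
    ([independent_mod_null_string]).  If the [p]-socle is finite and the
    [p]-component is not, then multiplication by [p] has finite fibres and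
    Koenig's lemma produces a null string for it
    ([finite_socle_null_string]); this is the Pruefer group case. *)

Set Implicit Arguments.
Unset Strict Implicit.
Unset Printing Implicit Defensive.
Import Order.TTheory GRing.Theory Num.Theory.

Local Open Scope classical_set_scope.
Local Open Scope ring_scope.

(** * Subgroups, restricted endomorphisms and string numbers *)

(** Excluded middle turns a propositional description of a subgroup into the
    boolean predicate that [zmodClosed] requires. *)
Lemma zmodClosed_of_Prop (G : zmodType) (P : G -> Prop) :
  P 0 -> (forall x y, P x -> P y -> P (x - y)) ->
  exists H : zmodClosed G, forall x, x \in H <-> P x.
Proof.
move=> P0 PB.
pose S : {pred G} := [pred x | `[< P x >]].
have SP x : x \in S <-> P x by split=> /asboolP.
have SB : zmod_closed S.
  by split=> [|x y /SP Px /SP Py]; apply/SP => //; apply: PB.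
pose SC := GRing.isZmodClosed.Build G S SB.
by exists (HB.pack_for (zmodClosed G) S SC).
Qed.

Lemma subgroup_lift (G : zmodType) (H : zmodClosed G) (x : G) :
  x \in H -> exists v : subgroup H, val v = x.
Proof. by move=> xH; exists (exist _ x xH). Qed.

Lemma val_subgroupB (G : zmodType) (H : zmodClosed G) (u v : subgroup H) :
  val (u - v) = val u - val v.
Proof. by []. Qed.

Lemma val_subgroup0 (G : zmodType) (H : zmodClosed G) : val (0 : subgroup H) = 0.
Proof. by []. Qed.

Lemma val_subgroupMn (G : zmodType) (H : zmodClosed G) (u : subgroup H) n :
  val (u *+ n) = val u *+ n.
Proof. by rewrite raddfMn. Qed.

Lemma additive_of_zmod_morphism (A B : zmodType) (f : A -> B) :
  zmod_morphism f -> exists g : {additive A -> B}, g =1 f.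
Proof.
move=> fB; pose fC := GRing.isZmodMorphism.Build A B f fB.
by exists (HB.pack_for {additive A -> B} f fC).
Qed.

(** The only family of null strings is then the empty one. *)
Lemma null_string_free0 (R : realType) (G : zmodType) (phi : {additive G -> G}) :
  (forall x, ~ null_string phi x) -> string_number_end R phi = 0%E.
Proof.
move=> nos; apply/eqP; rewrite eq_le; apply/andP; split.
  apply: ge_ereal_sup => _ [F [FN _] <-].
  suff -> : F = set0 by rewrite /counting asboolT // fset_set0 cardfs0.
  by apply/seteqP; split=> // x /FN /nos.
apply: ereal_sup_ubound; exists set0; first by split=> [x []|i j []].
by rewrite /counting asboolT // fset_set0 cardfs0.
Qed.

Lemma string_number_end_ge1 (R : realType) (G : zmodType)
    (phi : {additive G -> G}) x :
  null_string phi x -> (1 <= string_number_end R phi)%E.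
Proof.
move=> xN; apply: ereal_sup_ubound; exists [set x].
  by split=> [_ -> //|]; apply: trivIset1.
by rewrite /counting asboolT ?fset_set1 ?cardfs1 //; apply: finite_set1.
Qed.

Definition null_string_in_subgroup (G : zmodType) : Prop :=
  exists (H : zmodClosed G) (phi : {additive subgroup H -> subgroup H}) x,
    null_string phi x.

(** Each supremum involved is taken over a nonempty set of values that are
    either [0] or at least [1], so the whole invariant reduces to the existence
    of a single null string. *)
Lemma hereditary_string_number_eq0P (R : realType) (G : zmodType) :
  hereditary_string_number R G = 0%E <-> ~ null_string_in_subgroup G.
Proof.
split=> [s0 [H [phi [x /(string_number_end_ge1 R) s1]]]|nostring].
  suff : (1 <= 0 :> \bar R)%E by rewrite lee_fin ler10.
  rewrite -s0; apply: le_trans s1 _.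
  apply: (@le_trans _ _ (string_number R (subgroup H))).
    by apply: ereal_sup_ubound; exists phi.
  by apply: ereal_sup_ubound; exists H.
have nos (H : zmodClosed G) (phi : {additive subgroup H -> subgroup H}) x :
    ~ null_string phi x by move=> xN; apply: nostring; exists H, phi, x.
have sE (H : zmodClosed G) :
    range (@string_number_end R (subgroup H)) = [set 0%E].
  apply/seteqP; split=> [_ [phi _ <-]|_ ->].
    by rewrite null_string_free0 //; apply: nos.
  have zB : zmod_morphism (fun _ : subgroup H => 0 : subgroup H).
    by move=> x y; rewrite subr0.
  have [z _] := additive_of_zmod_morphism zB.
  by exists z => //; rewrite null_string_free0 //; apply: nos.
rewrite /hereditary_string_number.
suff -> : range (fun H : zmodClosed G => string_number R (subgroup H)) =
  [set 0%E] by exact: ereal_sup1.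
apply/seteqP; split=> [_ [H _ <-]|_ ->].
  by rewrite /string_number sE ereal_sup1.
have [H _] : exists H : zmodClosed G, forall x, x \in H <-> True.
  exact: zmodClosed_of_Prop.
by exists H => //; rewrite /string_number sE ereal_sup1.
Qed.

(** * Backward orbits of an additive map *)

Lemma backward_orbit_iter (T : Type) (f : T -> T) (y : nat -> T) :
  (forall n, f (y n.+1) = y n) -> forall m n, iter m f (y (m + n)%N) = y n.
Proof. by move=> fy; elim=> [|m IH] n //=; rewrite addSnnS IH fy. Qed.

Lemma iter_additive0 (A : zmodType) (f : {additive A -> A}) n : iter n f 0 = 0.
Proof. by elim: n => //= n ->; rewrite raddf0. Qed.

Lemma iter_additiveB (A : zmodType) (f : {additive A -> A}) n :
  zmod_morphism (iter n f).
Proof. by move=> x y; elim: n => //= n ->; rewrite raddfB. Qed.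

(** The orbit reaches [y 0] after [n] steps and [0] at the next one. *)
Lemma backward_orbit_kill (A : zmodType) (f : {additive A -> A}) (y : nat -> A) :
  (forall n, f (y n.+1) = y n) -> f (y 0%N) = 0 ->
  forall m n, (n < m)%N -> iter m f (y n) = 0.
Proof.
move=> fy f0 m n nm; have := backward_orbit_iter fy n 0; rewrite addn0 => yn.
by rewrite -(subnK nm) addnS -addSn iterD yn iterSr f0 iter_additive0.
Qed.

(** For [n < m] the power [f ^ m] kills [y n] but sends [y m] to [y 0]. *)
Lemma backward_orbit_inj (A : zmodType) (f : {additive A -> A}) (y : nat -> A) :
  (forall n, f (y n.+1) = y n) -> y 0%N <> 0 -> f (y 0%N) = 0 -> injective y.
Proof.
move=> fy y0 f0.
have ne m n : (n < m)%N -> y n <> y m.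
  move=> nm ynm; apply: y0; rewrite -(backward_orbit_iter fy m 0) addn0 -ynm.
  exact: backward_orbit_kill.
move=> m n ymn; case: (ltngtP m n) => // [/ne|/ne]; first by rewrite ymn.
by rewrite ymn.
Qed.

Lemma backward_orbit_null_string (A : zmodType) (f : {additive A -> A})
    (y : nat -> A) :
  (forall n, f (y n.+1) = y n) -> y 0%N <> 0 -> f (y 0%N) = 0 ->
  null_string f y.
Proof.
by move=> fy y0 f0; split=> //; [apply: backward_orbit_inj f0|exists 1%N].
Qed.

Definition Z_free_sequence (G : zmodType) (y : nat -> G) : Prop :=
  forall N (c : nat -> int), \sum_(i < N) y i *~ c i = 0 ->
  forall i, (i < N)%N -> c i = 0.

(** Applying [f ^ (N - 1)] to a relation of length [N] leaves only its top term,
    transported to [y 0]; so the top coefficient vanishes, and induction on the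
    length applies. *)
Lemma backward_orbit_free (A : zmodType) (f : {additive A -> A}) (y : nat -> A) :
  (forall n, f (y n.+1) = y n) -> f (y 0%N) = 0 ->
  (forall k : int, y 0%N *~ k = 0 -> k = 0) -> Z_free_sequence y.
Proof.
move=> fy f0 y0; elim=> [//|N IH] c; rewrite big_ord_recr /= => s0.
have [g gE] := additive_of_zmod_morphism (@iter_additiveB _ f N).
have cN : c N = 0.
  apply: y0; rewrite -[y 0%N](backward_orbit_iter fy N 0) addn0 -gE -raddfMz.
  have := congr1 g s0; rewrite raddfD raddf0 raddf_sum big1 ?add0r //.
  move=> i _; rewrite raddfMz gE backward_orbit_kill ?mul0rz //.
move: s0; rewrite cN mulr0z addr0 => s0 i.
rewrite ltnS leq_eqVlt => /orP[/eqP -> //|]; exact: IH s0 i.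
Qed.

(** The subgroup of elements with an infinite backward orbit is stable under
    [phi], since a backward orbit may be prolonged by [phi h] in front, and
    [phi] maps it onto itself, since a backward orbit may be truncated. *)
Lemma hereditarily_hopfian_string_free (G : zmodType) :
  hereditarily_hopfian G -> ~ null_string_in_subgroup G.
Proof.
move=> hopf [H [phi [x [_ xS x0 [k _ xk]]]]].
pose P (g : G) := exists y : nat -> subgroup H,
  val (y 0%N) = g /\ forall n, phi (y n.+1) = y n.
have [||V VP] := @zmodClosed_of_Prop G P.
- by exists (fun=> 0); rewrite val_subgroup0; split=> // n; rewrite raddf0.
- move=> g h [y [y0 yS]] [z [z0 zS]]; exists (fun n => y n - z n).
  by rewrite val_subgroupB y0 z0; split=> // n; rewrite raddfB yS zS.
have exj (v : subgroup V) : exists h : subgroup H, val h = val v.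
  by have /VP[y [y0 _]] := valP v; exists (y 0%N).
have [j jE] := choice exj.
have expsi (v : subgroup V) : exists w : subgroup V, val w = val (phi (j v)).
  have /VP[y [y0 yS]] := valP v.
  apply/subgroup_lift/VP; exists (fun n => if n is n'.+1 then y n' else phi (j v)).
  split=> // -[|n]; last exact: yS.
  by congr (phi _); apply: val_inj; rewrite jE.
have [psi psiE] := choice expsi.
(* [j] is the inclusion of [V] into [H], and [psi] the restriction of [phi]. *)
have jB : zmod_morphism j.
  by move=> u v; apply: val_inj; rewrite val_subgroupB !jE.
have psiB : zmod_morphism psi.
  by move=> u v; apply: val_inj; rewrite val_subgroupB !psiE jB raddfB.
have [psi' psi'E] := additive_of_zmod_morphism psiB.
have psi_surj v : exists u, psi' u = v.
  have /VP[y [y0 yS]] := valP v.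
  have [|u uE] := @subgroup_lift _ V (val (y 1%N)).
    by apply/VP; exists (fun n => y n.+1).
  exists u; rewrite psi'E; apply: val_inj; rewrite psiE -y0 -yS.
  by congr (val (phi _)); apply: val_inj; rewrite jE.
have psi_inj := bij_inj (hopf V psi' psi_surj).
have iter_inj : injective (iter k psi').
  by elim: (k) => //= n IH a b /psi_inj /IH.
have jiter n v : j (iter n psi' v) = iter n phi (j v).
  by elim: n => //= n <-; apply: val_inj; rewrite jE psi'E psiE.
have [|u uE] := @subgroup_lift _ V (val (x 0%N)); first by apply/VP; exists x.
have jx : j u = x 0%N by apply: val_inj; rewrite jE.
suff u0 : u = 0 by apply: x0; apply: val_inj; rewrite -uE u0 !val_subgroup0.
apply: iter_inj; rewrite iter_additive0; apply: val_inj.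
by rewrite -jE jiter jx xk !val_subgroup0.
Qed.

(** * Finiteness conditions force surjective endomorphisms to be injective *)

Lemma Z_free_sequence_independent (G : zmodType) (y : nat -> G) :
  injective y -> Z_free_sequence y -> Z_independent (range y).
Proof.
move=> y_inj y_free X c Xy sX x xX.
have [N XN] : exists N, {subset X <= [seq y i | i <- iota 0 N]}.
  suff : forall s : seq G, (forall t, t \in s -> range y t) ->
      exists N, {subset s <= [seq y i | i <- iota 0 N]}.
    by apply=> t tX; apply: Xy.
  elim=> [|z s IH] sy; first by exists 0%N.
  have [|N sN] := IH; first by move=> t ts; apply: sy; rewrite inE ts orbT.
  have [i _ <-] := sy z (mem_head _ _); exists (maxn N i.+1) => t.
  rewrite inE => /orP[/eqP ->|/sN /mapP[j]].
    by rewrite map_f // mem_iota /= add0n leq_max ltnSn orbT.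
  rewrite mem_iota => /= jN ->; rewrite map_f // mem_iota /= add0n leq_max.
  by rewrite jN.
(* The combination over [X] is rewritten over an initial segment of [y]. *)
pose d i := if y i \in X then c (y i) else 0.
have /mapP[i iN xE] := XN x xX.
rewrite mem_iota /= add0n in iN.
suff : d i = 0 by rewrite /d -xE xX.
apply: (y_free N) iN; rewrite -[RHS]sX.
transitivity (\sum_(z <- [seq y i | i <- iota 0 N] | z \in X) z *~ c z).
  rewrite big_map [RHS]big_mkcond -(big_mkord predT (fun i => y i *~ d i)).
  rewrite /index_iota subn0 /=; apply: eq_bigr => j _; rewrite /d.
  by case: ifP => // _; rewrite mulr0z.
rewrite -big_filter; apply/perm_big/uniq_perm.
- by rewrite filter_uniq // map_inj_uniq // iota_uniq.
- exact: fset_uniq.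
- by move=> z; rewrite mem_filter andb_idr // => /XN.
Qed.

Lemma infinite_range (T : Type) (y : nat -> T) :
  injective y -> infinite_set (range y).
Proof.
move=> y_inj yfin; apply: infinite_nat.
suff <- : y @^-1` range y = [set: nat].
  by apply: finite_preimage yfin => i j _ _ /y_inj.
by apply/seteqP; split=> // i _; exists i.
Qed.

Lemma free_sequence_rank (R : realType) (G : zmodType) (y : nat -> G) :
  injective y -> Z_free_sequence y -> torsion_free_rank R G = +oo%E.
Proof.
move=> y_inj y_free; apply/eqP; rewrite -leye_eq; apply: ereal_sup_ubound.
exists (range y); first exact: Z_free_sequence_independent.
by rewrite /counting asboolF //; apply: infinite_range.
Qed.

(** A condition [Q] that passes to some preimage propagates along a whole
    backward orbit, by dependent choice. *)
Lemma backward_orbit_within (T : Type) (f : T -> T) (Q : T -> Prop) :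
  (forall z, Q z -> exists2 w, Q w & f w = z) ->
  forall x, Q x -> exists y : nat -> T,
    [/\ y 0%N = x, forall n, Q (y n) & forall n, f (y n.+1) = y n].
Proof.
move=> lift x Qx.
have exs z : exists w, Q z -> Q w /\ f w = z.
  have [/lift[w Qw wz]|nQ] := pselect (Q z); first by exists w.
  by exists z.
have [s sE] := choice exs.
have Qy n : Q (iter n s x) by elim: n => //= n /sE[].
by exists (fun n => iter n s x); split=> // n; have /sE[] := Qy n.
Qed.

(** A kernel element of infinite order would start a backward orbit that is an
    infinite independent sequence. *)
Lemma surjective_kernel_torsion (A : zmodType) (f : {additive A -> A}) :
  (forall z, exists w, f w = z) ->
  (forall y : nat -> A, injective y -> ~ Z_free_sequence y) ->
  forall x, f x = 0 -> exists2 n, (0 < n)%N & x *+ n = 0.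
Proof.
move=> f_surj nofree x fx; apply: contrapT => xfree.
have [|y [y0 _ fy]] := @backward_orbit_within A f (fun=> True) _ x I.
  by move=> z _; have [w <-] := f_surj z; exists w.
have x0 (k : int) : x *~ k = 0 -> k = 0.
  case: k => [[|n]|n]; rewrite ?NegzE ?mulrNz //.
    by move=> xn; case: xfree; exists n.+1.
  by move=> /eqP; rewrite oppr_eq0 => /eqP xn; case: xfree; exists n.+1.
apply: (nofree y).
  apply: (backward_orbit_inj fy); rewrite y0 // => x00.
  by have := x0 1; rewrite x00 mul0rz => /(_ erefl).
by apply: (backward_orbit_free fy); rewrite y0.
Qed.

(** A preimage [w0] of [z] has finite order because [w0 *+ p ^ a] lies in the
    kernel.  Its [p]-part is still a preimage: it is a multiple [w0 *+ u] with
    [u] congruent to [1] modulo [p ^ a], which annihilates [z], and to [0]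
    modulo the prime-to-[p] part of an exponent that annihilates [w0]. *)
Lemma p_component_lift (A : zmodType) (f : {additive A -> A}) (p : nat) :
  prime p -> (forall z, exists w, f w = z) ->
  (forall x, f x = 0 -> exists2 n, (0 < n)%N & x *+ n = 0) ->
  forall z, p_component p A z -> exists2 w, p_component p A w & f w = z.
Proof.
move=> p_pr f_surj ktors z [a za]; have [w0 fw0] := f_surj z.
have [|n n_gt0] := ktors (w0 *+ (p ^ a)); first by rewrite raddfMn /= fw0.
rewrite -mulrnA => w0n; set N := (_ * n)%N in w0n.
have N_gt0 : (0 < N)%N by rewrite muln_gt0 expn_gt0 prime_gt0.
have co : coprime (p ^ a) N`_(p^')%N.
  by rewrite coprimeXl // prime_coprime // -p'natE // part_pnat.
pose u := chinese (p ^ a) N`_(p^')%N 1 0.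
have /eqP/dvdnP[v uE] : (u %% N`_(p^')%N = 0)%N by rewrite chinese_modr ?mod0n.
exists (w0 *+ u).
  exists (logn p N); rewrite uE -mulrnA -p_part -mulnA.
  by rewrite [X in (v * X)%N]mulnC partnC // mulnC mulrnA w0n mul0rn.
rewrite raddfMn /= fw0 (divn_eq u (p ^ a)) chinese_modl // mulrnDr mulnC mulrnA.
(* When [a = 0] the residue of [1] modulo [p ^ a] is [0], but then [z = 0]. *)
rewrite za mul0rn add0r; case: (a) za => [|b] za.
  by rewrite expn0 modn1 mulr0n -za expn0.
by rewrite modn_small // -(exp1n b.+1) ltn_exp2r // prime_gt1.
Qed.

Lemma torsion_prime_multiple (A : zmodType) (x : A) n :
  (0 < n)%N -> x *+ n = 0 -> x <> 0 ->
  exists p m, [/\ prime p, x *+ m <> 0 & x *+ m *+ p = 0].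
Proof.
move=> n_gt0 xn x0.
have ex : exists n, (0 < n)%N && (x *+ n == 0).
  by exists n; rewrite n_gt0 xn eqxx.
case: (ex_minnP ex) => k /andP[k_gt0 /eqP xk] k_min.
have k_gt1 : (1 < k)%N.
  by case: k k_gt0 xk {k_min} => [|[|]] // _ xk; case: x0.
exists (pdiv k), (k %/ pdiv k)%N; split; first exact: pdiv_prime.
  move=> x'0; have : (k <= k %/ pdiv k)%N.
    apply: k_min; rewrite x'0 eqxx andbT divn_gt0 ?pdiv_gt0 // dvdn_leq //.
    exact: pdiv_dvd.
  by rewrite leqNgt ltn_Pdiv // prime_gt1 // pdiv_prime.
by rewrite -mulrnA divnK ?pdiv_dvd.
Qed.

(** A nonzero kernel element yields one of prime order [p], and the backward
    orbit of the latter inside the [p]-component has infinitely many terms. *)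
Lemma finite_components_rank_hopfian (R : realType) (G : zmodType) :
  (forall p : nat, prime p -> finite_set (p_component p G)) ->
  (torsion_free_rank R G < +oo)%E -> hereditarily_hopfian G.
Proof.
move=> pfin rfin H f f_surj.
have nofree (y : nat -> subgroup H) : injective y -> ~ Z_free_sequence y.
  move=> y_inj y_free.
  suff yoo : torsion_free_rank R G = +oo%E by rewrite yoo in rfin.
  apply: (@free_sequence_rank _ _ (val \o y)); first exact: inj_comp val_inj y_inj.
  move=> N c s0; apply: y_free; apply: val_inj; rewrite raddf_sum -[RHS]s0.
  by apply: eq_bigr => i _; rewrite raddfMz.
have ktors := surjective_kernel_torsion f_surj nofree.
have ker0 x : f x = 0 -> x = 0.
  move=> fx; apply: contrapT => x0; have [n n_gt0 xn] := ktors x fx.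
  have [p [m [p_pr xm xmp]]] := torsion_prime_multiple n_gt0 xn x0.
  have [|y [y0 yp fy]] := backward_orbit_within (p_component_lift p_pr f_surj ktors)
    (x := x *+ m); first by exists 1%N; rewrite expn1.
  have y_inj : injective y.
    by apply: (backward_orbit_inj fy); rewrite y0 ?raddfMn /= ?fx ?mul0rn.
  apply: (infinite_range (inj_comp val_inj y_inj)).
  apply: sub_finite_set (pfin p p_pr) => _ [i _ <-] /=.
  by have [k yk] := yp i; exists k; rewrite -val_subgroupMn yk val_subgroup0.
have f_inj : injective f.
  move=> u v fuv; apply/eqP; rewrite -subr_eq0; apply/eqP/ker0.
  by rewrite raddfB fuv subrr.
have [g gK] := choice f_surj.
by exists g => // v; apply: f_inj; rewrite gK.
Qed.

(** * Shifts on spans of independent sequences *)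

Definition Z_span (G : zmodType) (s : seq G) : set G :=
  [set \sum_(i < size s) s`_i *~ c i | c in [set: nat -> int]].

(** For [m = 0] this is linear independence over [Z]; for a prime [m] it is
    linear independence over [Z/m] inside the [m]-socle. *)
Definition independent_mod (G : zmodType) (m : nat) (e : nat -> G) : Prop :=
  (forall i, e i *+ m = 0) /\
  forall N (c : nat -> int), \sum_(i < N) e i *~ c i = 0 ->
    forall i, (i < N)%N -> (m%:Z %| c i)%Z.

(** The inductive step in the construction of a sequence independent modulo [m]:
    any finite list of elements killed by [m] can be prolonged. *)
Definition mod_extendible (G : zmodType) (m : nat) : Prop :=
  forall s : seq G, (forall t, t \in s -> t *+ m = 0) ->
  exists2 x : G, x *+ m = 0 &
    forall k : int, Z_span s (x *~ k) -> (m%:Z %| k)%Z.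

Lemma mulrz_dvd (G : zmodType) (m : nat) (x : G) (k : int) :
  x *+ m = 0 -> (m%:Z %| k)%Z -> x *~ k = 0.
Proof. by move=> xm /dvdzP[q ->]; rewrite mulrC mulrzA -pmulrn xm mul0rz. Qed.

Lemma mod_extendible_independent (G : zmodType) (m : nat) :
  mod_extendible G m -> exists e : nat -> G, independent_mod m e.
Proof.
move=> ext.
have exg (s : seq G) : exists x, (forall t, t \in s -> t *+ m = 0) ->
    x *+ m = 0 /\ forall k : int, Z_span s (x *~ k) -> (m%:Z %| k)%Z.
  have [/ext[x xm xs]|ns] := pselect (forall t, t \in s -> t *+ m = 0).
    by exists x.
  by exists 0.
have [g gP] := choice exg.
(* The choice function [g] is iterated on the list of the previous terms. *)
pose l n := iter n (fun s => rcons s (g s)) [::]; pose e n := g (l n).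
have lE n : l n = mkseq e n by elim: n => //= n IH; rewrite mkseqS -IH.
have lm n t : t \in l n -> t *+ m = 0.
  elim: n t => //= n IH t; rewrite mem_rcons inE => /orP[/eqP ->|/IH //].
  by have [] := gP _ IH.
exists e; split=> [i|]; first by have [] := gP _ (@lm i).
elim=> // N IH c; rewrite big_ord_recr /= => s0.
have [eNm eN] := gP _ (@lm N); rewrite -/(e N) in eNm eN.
have mc : (m%:Z %| c N)%Z.
  apply: eN; exists (fun i => - c i) => //.
  rewrite lE size_mkseq -[RHS](addKr (\sum_(i < N) e i *~ c i)) s0 addr0 -sumrN.
  by apply: eq_bigr => i _; rewrite nth_mkseq // mulrNz.
move: s0; rewrite (mulrz_dvd eNm mc) addr0 => s0 i.
rewrite ltnS leq_eqVlt => /orP[/eqP -> //|]; exact: IH s0 i.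
Qed.

(** Polynomials serve as finitely supported coefficient sequences, on which
    [drop_poly 1] is the shift; this is the linear map with ['X^n |-> e n]. *)
Definition poly_comb (G : zmodType) (e : nat -> G) (q : {poly int}) : G :=
  \sum_(i < size q) e i *~ q`_i.

Lemma poly_comb_widen (G : zmodType) (e : nat -> G) (q : {poly int}) N :
  (size q <= N)%N -> poly_comb e q = \sum_(i < N) e i *~ q`_i.
Proof.
move=> qN; rewrite /poly_comb (big_ord_widen N (fun i => e i *~ q`_i)) //.
rewrite big_mkcond; apply: eq_bigr => i _; case: ltnP => // qi.
by rewrite nth_default // mulr0z.
Qed.

Lemma poly_combB (G : zmodType) (e : nat -> G) :
  zmod_morphism (poly_comb e).
Proof.
move=> p q; pose N := maxn (size p) (size q).
have pN : (size p <= N)%N by rewrite leq_maxl.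
have qN : (size q <= N)%N by rewrite leq_maxr.
have pqN : (size (p - q)%R <= N)%N.
  by rewrite (leq_trans (size_polyD _ _)) // size_polyN.
rewrite !(@poly_comb_widen _ _ _ N) // -sumrB.
by apply: eq_bigr => i _; rewrite coefB mulrzBr.
Qed.

Lemma poly_combXn (G : zmodType) (e : nat -> G) n :
  poly_comb e 'X^n = e n.
Proof.
rewrite /poly_comb size_polyXn big_ord_recr /= big1 ?add0r => [|i _].
  by rewrite coefXn eqxx.
by rewrite coefXn ltn_eqF // mulr0z.
Qed.

(** The relations between the terms of [e] are exactly the coefficient sequences
    divisible by [m], a condition stable under the shift of coefficients.  So
    [e n.+1 |-> e n], [e 0 |-> 0] defines an endomorphism of the subgroup
    generated by [e], for which [e] is a null string. *)
Lemma independent_mod_null_string (G : zmodType) (m : nat) (e : nat -> G) :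
  m != 1%N -> independent_mod m e -> null_string_in_subgroup G.
Proof.
move=> m1 [em e_indep]; pose F := poly_comb e.
have F0 : F 0 = 0 by rewrite /F /poly_comb size_poly0 big_ord0.
have [||H HP] := @zmodClosed_of_Prop G (fun g => exists q, g = F q).
- by exists 0.
- by move=> _ _ [p ->] [q ->]; exists (p - q); rewrite /F poly_combB.
have shift0 q : F q = 0 -> F (drop_poly 1 q) = 0.
  move=> Fq; rewrite /F /poly_comb big1 // => i _.
  rewrite coef_drop_poly addn1; apply: mulrz_dvd => //.
  have [iq|qi] := ltnP i.+1 (size q); first exact: (e_indep (size q)).
  by rewrite nth_default // dvdz0.
have shift_wd p q : F p = F q -> F (drop_poly 1 p) = F (drop_poly 1 q).
  move=> Fpq; apply/eqP; rewrite -subr_eq0 -poly_combB -raddfB; apply/eqP.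
  by apply: shift0; rewrite /F poly_combB -/F Fpq subrr.
have exr (v : subgroup H) : exists q, val v = F q by apply/HP/valP.
have [r rE] := choice exr.
have exphi (v : subgroup H) :
    exists w : subgroup H, val w = F (drop_poly 1 (r v)).
  by apply: subgroup_lift; apply/HP; exists (drop_poly 1 (r v)).
have [phi0 phi0E] := choice exphi.
have phi0B : zmod_morphism phi0.
  move=> u v; apply: val_inj; rewrite val_subgroupB !phi0E.
  rewrite -poly_combB -raddfB; apply: shift_wd.
  by rewrite -rE val_subgroupB !rE /F poly_combB.
have [phi phiE] := additive_of_zmod_morphism phi0B.
have exx n : exists v : subgroup H, val v = e n.
  by apply: subgroup_lift; apply/HP; exists 'X^n; rewrite /F poly_combXn.
have [x xE] := choice exx.
have rx n : F (drop_poly 1 (r (x n))) = F (drop_poly 1 'X^n).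
  by apply: shift_wd; rewrite -rE xE /F poly_combXn.
exists H, phi, x; apply: backward_orbit_null_string => [n| |].
- apply: val_inj; rewrite phiE phi0E rx xE exprSr.
  rewrite -[X in drop_poly _ X]add0r drop_polyDMXn ?size_poly0 //.
  by rewrite /F poly_combXn.
- move=> x0; have e0 : e 0%N = 0 by rewrite -xE x0.
  have := @e_indep 1%N (fun=> 1) _ 0%N isT; rewrite big_ord1 e0 mul0rz.
  by move=> /(_ erefl); rewrite dvdz1 /= (negPf m1).
- apply: val_inj; rewrite phiE phi0E rx /= drop_poly_eq0 // size_polyXn //.
Qed.

(** In the Smith normal form [L *m D *m S] of [M] the row of [D] with index [n]
    is zero, so the row of index [n] of the inverse of [L] is a relation. *)
Lemma int_rows_dependent (m n : nat) (M : 'M[int]_(m, n)) :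
  (n < m)%N -> exists2 c : 'rV[int]_m, c != 0 & c *m M = 0.
Proof.
move=> nm; have [L L_unit [S _ [d _ ->]]] := int_Smith_normal_form M.
pose i := Ordinal nm; exists (delta_mx 0 i *m invmx L).
  apply/eqP => /(congr1 (mulmx^~ L)); rewrite mulmxKV // mul0mx.
  by move=> /matrixP/(_ 0 i); rewrite !mxE !eqxx.
rewrite !mulmxA mulmxKV // (_ : delta_mx 0 i *m _ = 0) ?mul0mx //.
by apply/rowP => j; rewrite -rowE !mxE gtn_eqF.
Qed.

(** If a list [s] cannot be prolonged, every [x] has a nonzero multiple in the
    span of [s].  The coefficients of these multiples are rows of length
    [size s], so more than [size s] elements are always dependent and the rank
    is at most [size s]. *)
Lemma infinite_rank_extendible (R : realType) (G : zmodType) :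
  ~ (torsion_free_rank R G < +oo)%E -> mod_extendible G 0.
Proof.
move=> roo s _; apply: contrapT => noext; apply: roo.
have exk (x : G) : exists kc : int * (nat -> int),
    kc.1 <> 0 /\ x *~ kc.1 = \sum_(j < size s) s`_j *~ kc.2 j.
  apply: contrapT => nok; apply: noext; exists x => // k [c _ cE].
  by rewrite dvd0z; apply/eqP; apply: contrapT => k0; apply: nok; exists (k, c).
have [kc kcP] := choice exk.
have small (X : {fset G}) (A : set G) : Z_independent A -> [set` X] `<=` A ->
    (#|` X| <= size s)%N.
  move=> A_indep XA; rewrite leqNgt; apply/negP => sX.
  pose t : seq G := X.
  have [c /eqP c0 cM] := int_rows_dependent
    (\matrix_(i < #|` X|, j < size s) (kc t`_i).2 j) sX.
  (* [d] gives the [i]-th element of [X] the coefficient [c_i] times the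
     multiplier that brings this element into the span of [s]. *)
  pose d (x : G) : int := oapp (fun i => c 0 i * (kc x).1) 0 (insub (index x t)).
  have dE (i : 'I_(#|` X|)) : d t`_i = c 0 i * (kc t`_i).1.
    rewrite /d index_uniq ?fset_uniq // insubT //= => iX.
    by congr (c 0 _ * _); apply: val_inj.
  apply: c0; apply/rowP => i; rewrite mxE.
  have : d t`_i = 0.
    apply: (A_indep X) => //; last by rewrite mem_nth.
    rewrite (big_nth 0) big_mkord.
    under eq_bigr => j _ do rewrite dE mulrC mulrzA (kcP _).2 mulrz_suml.
    rewrite exchange_big big1 //= => j _.
    transitivity (s`_j *~ ((c *m \matrix_(i, j) (kc t`_i).2 j) 0 j)).
      rewrite mxE mulrz_sumr; apply: eq_bigr => a _.
      by rewrite mxE -mulrzA mulrC.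
    by rewrite cM mxE mulr0z.
  rewrite dE => /eqP; rewrite mulf_eq0 => /orP[/eqP //|/eqP k0].
  by have [] := kcP t`_i.
apply: (@le_lt_trans _ _ (size s)%:R%:E); last exact: ltry.
apply: ge_ereal_sup => _ [A A_indep <-]; rewrite /counting.
have [Afin|Ainf] := pselect (finite_set A).
  rewrite asboolT // lee_fin ler_nat; apply: (small _ A) => //.
  by rewrite fset_setK.
have [X XA sX] := infinite_set_fset (size s).+1 Ainf.
by have := small X A A_indep XA; rewrite leqNgt sX.
Qed.

(** * Infinite primary components *)

(** Coefficients matter only modulo [p]. *)
Lemma Z_span_finite (G : zmodType) (p : nat) (s : seq G) :
  (0 < p)%N -> (forall t, t \in s -> t *+ p = 0) -> finite_set (Z_span s).
Proof.
case: p => // p _ sp.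
pose F (a : {ffun 'I_(size s) -> 'I_p.+1}) := \sum_(i < size s) s`_i *+ a i.
apply: (@sub_finite_set _ _ (F @` setT)); last exact/finite_image/finite_finset.
move=> _ [c _ <-]; exists [ffun i : 'I_(size s) => inord `|(c i %% p.+1)%Z|] => //.
apply: eq_bigr => i _; rewrite ffunE inordK; last first.
  by rewrite -ltz_nat gez0_abs ?modz_ge0 // ltz_pmod.
rewrite {2}(divz_eq (c i) p.+1) mulrzDr mulrC mulrzA -!pmulrn sp ?mem_nth //.
by rewrite mul0rz add0r pmulrn gez0_abs // modz_ge0.
Qed.

(** Any [x] of the socle outside the finite span of [s] works: if [p] does not
    divide [k], Bezout's identity recovers [x] from [x *~ k]. *)
Lemma infinite_socle_extendible (G : zmodType) (p : nat) :
  prime p -> infinite_set [set x : G | x *+ p = 0] -> mod_extendible G p.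
Proof.
move=> p_pr Ginf s sp.
have [x [/= xp xs]] := infinite_setN0
  (infinite_setD Ginf (Z_span_finite (prime_gt0 p_pr) sp)).
exists x => // k [c _ cE]; apply: contrapT => /negP pk; apply: xs.
have /eqP co : coprimez p k by rewrite coprimezE prime_coprime.
have [u [v]] := Bezoutz p k; rewrite co => uv.
exists (fun i => c i * v) => //; rewrite -[RHS](mulr1z x) -uv mulrzDr.
rewrite (mulrC u) (mulrC v) !mulrzA -pmulrn xp mul0rz add0r -cE.
by rewrite mulrz_suml; apply: eq_bigr => i _; rewrite mulrzA.
Qed.

(** Koenig's lemma for the tree in which the children of [x] are the solutions
    [y] of [y *+ p = x].  They form a coset of the finite socle or the empty
    set, so an element with infinitely many descendants has a child with the same
    property. *)
Lemma finite_socle_null_string (G : zmodType) (p : nat) :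
  finite_set [set x : G | x *+ p = 0] -> infinite_set (p_component p G) ->
  null_string_in_subgroup G.
Proof.
move=> sfin tinf.
pose D (x : G) : set G := [set y | exists n, y *+ (p ^ n) = x].
have good_child x :
    infinite_set (D x) -> exists2 y, infinite_set (D y) & y *+ p = x.
  move=> Dx; apply: contrapT => nochild; apply: Dx.
  have childfin : finite_set [set y : G | y *+ p = x].
    have [[y0 y0x]|no] := pselect (exists y, y *+ p = x); last first.
      by apply: sub_finite_set (finite_set0 G) => y yx; apply: no; exists y.
    apply: sub_finite_set (finite_image (fun z => y0 + z) sfin) => y /= yx.
    exists (y - y0) => /=; last by rewrite addrC subrK.
    by rewrite mulrnBl yx y0x subrr.
  pose C := [set y : G | y *+ p = x].
  apply: (@sub_finite_set _ _ ([set x] `|` \bigcup_(y in C) D y)).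
    move=> z [[|n] zx]; first by left; rewrite /= -zx expn0.
    right; exists (z *+ (p ^ n)); last by exists n.
    by rewrite /C /= -mulrnA -expnSr.
  rewrite finite_setU; split; first exact: finite_set1.
  apply: bigcup_finite childfin _ => y yx; apply: contrapT => Dy.
  by apply: nochild; exists y.
(* The root [0] is its own child, so the first step must leave it
   explicitly. *)
have [x0 [x0p x0n Dx0]] :
    exists x, [/\ x *+ p = 0, x <> 0 & infinite_set (D x)].
  apply: contrapT => noroot; apply: tinf.
  pose S := [set x : G | x *+ p = 0] `\ 0.
  apply: (@sub_finite_set _ _ ([set 0] `|` \bigcup_(y in S) D y)).
    move=> z [n]; elim: n => [|n IH] zn; first by left; rewrite /= -zn expn0.
    have [z0|z0] := pselect (z *+ (p ^ n) = 0); first exact: IH.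
    right; exists (z *+ (p ^ n)); last by exists n.
    by split=> //=; rewrite -mulrnA -expnSr.
  rewrite finite_setU; split; first exact: finite_set1.
  apply: bigcup_finite; first exact: finite_setD.
  by move=> y [yp y0]; apply: contrapT => Dy; apply: noroot; exists y.
have [H HP] := @zmodClosed_of_Prop G (fun=> True) I (fun _ _ _ _ => I).
have pB : zmod_morphism (fun v : subgroup H => v *+ p).
  by move=> u v; rewrite mulrnBl.
have [phi phiE] := additive_of_zmod_morphism pB.
pose Q (v : subgroup H) := infinite_set (D (val v)).
have [v0 v0E] := subgroup_lift (iffRL (HP x0) I).
have [||y [y0 _ yS]] := @backward_orbit_within _ phi Q _ v0.
- move=> z /good_child[w Dw wz]; have [v vE] := subgroup_lift (iffRL (HP w) I).
  exists v; first by rewrite /Q vE.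
  by apply: val_inj; rewrite phiE val_subgroupMn vE.
- by rewrite /Q v0E.
exists H, phi, y; apply: backward_orbit_null_string => //; rewrite y0.
  by move=> v00; apply: x0n; rewrite -v0E v00.
by apply: val_inj; rewrite phiE val_subgroupMn v0E.
Qed.

Lemma string_free_finite_components_rank (R : realType) (G : zmodType) :
  ~ null_string_in_subgroup G ->
  (forall p : nat, prime p -> finite_set (p_component p G)) /\
  (torsion_free_rank R G < +oo)%E.
Proof.
move=> nos; split=> [p p_pr|]; apply: contrapT => inf; apply: nos; last first.
  have [e eP] := mod_extendible_independent (infinite_rank_extendible inf).
  exact: independent_mod_null_string eP.
have [sfin|sinf] := pselect (finite_set [set x : G | x *+ p = 0]).
  exact: finite_socle_null_string sfin inf.
have [e eP] := mod_extendible_independent (infinite_socle_extendible p_pr sinf).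
by apply: independent_mod_null_string eP; rewrite gtn_eqF // prime_gt1.
Qed.

Theorem corollary7p8 (R : realType) (G : zmodType) :
  [<-> hereditary_string_number R G = 0%E;
       (forall p : nat, prime p -> finite_set (p_component p G)) /\
         (torsion_free_rank R G < +oo)%E;
       hereditarily_hopfian G].
Proof.
split=> [/hereditary_string_number_eq0P|].
  exact: string_free_finite_components_rank.
split=> [[pfin rfin]|hopf]; first exact: finite_components_rank_hopfian rfin.
by apply/hereditary_string_number_eq0P; exact: hereditarily_hopfian_string_free.
Qed.
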